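(* Let $\lambda$ be an infinite cardinal number and let $X$ be a non-empty metric space such that every non-empty open subset of $X$ has density $\lambda$. Then $\mathrm{cof}(\mathrm{nwd}_{\lambda^\omega})=\mathrm{cof}(\mathrm{nwd}_X)$.
   Context: $\lambda^\omega$ carries the product topology, where $\lambda$ is equipped with the discrete topology. The density of a space is the minimal cardinality of a dense subset. For a topological space $Z$, $\mathrm{nwd}_Z$ denotes the ideal of all nowhere dense subsets of $Z$. For a family $\mathcal F$ of subsets of a set, $\mathrm{cof}(\mathcal F)$ is the minimal cardinality of a subfamily $\mathcal W\subseteq\mathcal F$ such that for every $Y\in\mathcal F$ there exists $Z\in\mathcal W$ with $Y\subseteq Z$. *)

(* Defs.v *)
From mathcomp Require Import all_boot all_order all_algebra.
From mathcomp Require Import all_classical all_reals topology.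

Set Implicit Arguments.
Unset Strict Implicit.
Unset Printing Implicit Defensive.

Local Open Scope classical_set_scope.
Local Open Scope card_scope.

(* Cardinals are represented by sets, compared with [#=] and [#<=]. *)

Lemma least_card_exists (U : Type) (P : set (set U)) : P !=set0 ->
  exists2 A, P A & forall B, P B -> A #<= B.
Proof.
move=> [P0 PP0].
pose Q (S : set (set U -> U)) :=
  (forall f, S f -> forall D, P D -> D (f D)) /\
  (forall f g, S f -> S g -> forall D, P D -> f D = g D -> f = g).
have [F FQ Ftot|S [[Sin Sinj] Smax]] := @Zorn_bigcup _ Q.
  split=> [f [X FX Xf]|f g [X FX Xf] [Y FY Yg] D PD fg].
    exact: (FQ _ FX).1.
  have [XY|YX] := Ftot _ _ FX FY.
    exact: ((FQ _ FY).2 f g (XY _ Xf) Yg D).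
  exact: ((FQ _ FX).2 f g Xf (YX _ Yg) D).
have [D [PD DS]] : exists D, P D /\ D `<=` [set f D | f in S].
  apply: contrapT => noD.
  have gP D : P D -> exists x, D x /\ forall f, S f -> f D <> x.
    move=> PD; apply: contrapT => nx; apply: noD; exists D; split=> // x Dx.
    apply: contrapT => Sx; apply: nx; exists x; split=> // f Sf fx.
    by apply: Sx; exists f.
  have [x0 _] := gP _ PP0.
  have {}gP D : exists x, P D -> D x /\ forall f, S f -> f D <> x.
    have [/gP[x ?]|nPD] := pselect (P D); first by exists x.
    by exists x0 => /nPD.
  have [g gE] := choice gP.
  apply: (Smax (S `|` [set g])).
    split; first by move=> f; left.
    by move=> /(_ g (or_intror erefl)) /((gE _ PP0).2 g).
  split=> [f [|->] D PD|f h]; first exact: Sin.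
    by have [] := gE _ PD.
  move=> [Sf|->] [Sh|->] D PD // fh; first exact: (Sinj _ _ Sf Sh D).
    by have [_ /(_ _ Sf)] := gE _ PD.
  by have [_ /(_ _ Sh)/(_ (esym fh))] := gE _ PD.
exists D => // B PB.
have DleS : D #<= S.
  exact: card_le_trans (subset_card_le DS) (card_image_le _ _).
apply: card_le_trans DleS _.
have injB : {in S &, injective (fun f : set U -> U => f B)}.
  by move=> f g /set_mem Sf /set_mem Sg; exact: (Sinj _ _ Sf Sg B).
have imB : [set f B | f in S] `<=` B.
  by move=> _ [f Sf <-]; exact: (Sin _ Sf B).
have /card_eqPle[_ SleI] := inj_card_eq injB.
exact: card_le_trans SleI (subset_card_le imB).
Qed.

(* A member of [P] of least cardinality; only its cardinality is meaningful. *)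
Definition least_card (U : Type) (P : set (set U)) (P0 : P !=set0) : set U :=
  projT1 (cid2 (least_card_exists P0)).

Lemma least_cardP (U : Type) (P : set (set U)) (P0 : P !=set0) :
  P (least_card P0) /\ forall B, P B -> least_card P0 #<= B.
Proof. by rewrite /least_card; case: cid2. Qed.

Lemma dense_nonempty (Z : topologicalType) : [set D : set Z | dense D] !=set0.
Proof. by exists setT => O [x Ox] _; exists x. Qed.

Definition density (Z : topologicalType) : set Z :=
  least_card (dense_nonempty Z).
Arguments density : clear implicits.

Definition nwd (Z : topologicalType) : set (set Z) :=
  [set A | (closure A)° = set0].
Arguments nwd : clear implicits.

Definition cofinal (T : Type) (F W : set (set T)) :=
  W `<=` F /\ forall Y, F Y -> exists2 Z, W Z & Y `<=` Z.

Lemma cofinal_nonempty (T : Type) (F : set (set T)) : cofinal F !=set0.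
Proof. by exists F; split=> // Y FY; exists Y. Qed.

Definition cof (T : Type) (F : set (set T)) : set (set T) :=
  least_card (cofinal_nonempty F).
Arguments cof {T} F.

(* Main.v *)
(* Both spaces carry a pi-base indexed by the tree of finite sequences over L, in
   which siblings are disjoint; in the metric space the children of a node form
   a maximal disjoint family of small open subsets, of size exactly L.  Between
   two spaces with such pi-bases U and V, the map sending a nowhere dense C to
   [set x | forall s, U s x -> V s `&` C !=set0] carries cofinal families of
   nowhere dense sets to cofinal families: given a nowhere dense Y, take C to
   contain one point of each V s such that U s meets Y. *)

Require Import Defs.
From mathcomp Require Import all_boot all_order all_algebra.
From mathcomp Require Import all_classical all_reals topology.

Set Implicit Arguments.
Unset Strict Implicit.
Unset Printing Implicit Defensive.

Import Order.TTheory GRing.Theory Num.Theory.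

Local Open Scope classical_set_scope.
Local Open Scope card_scope.

(** * Comparing cardinalities by injections *)

Lemma card_le_inj (T U : Type) (A : set T) (B : set U) (f : T -> U) :
  (forall x, A x -> B (f x)) ->
  (forall x y, A x -> A y -> f x = f y -> x = y) -> A #<= B.
Proof.
move=> fAB finj.
have inj : {in A &, injective f}.
  by move=> x y /set_mem Ax /set_mem Ay; exact: finj.
have /card_eqPle[_ AleI] := inj_card_eq inj.
apply: card_le_trans AleI (subset_card_le _).
by move=> _ [x Ax <-]; exact: fAB.
Qed.

Lemma card_le_injfun (T : Type) (U : pointedType) (A : set T) (B : set U) :
  A #<= B -> exists f : T -> U,
    (forall x, A x -> B (f x)) /\
    (forall x y, A x -> A y -> f x = f y -> x = y).
Proof.
move=> /pcard_leP/unsquash f; exists f; split; first exact: funS.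
by move=> x y Ax Ay; apply: inj; rewrite inE.
Qed.

Lemma card_le_total (T : Type) (A B : set T) : A #<= B \/ B #<= A.
Proof.
have [|C [->|->] Cmin] := @least_card_exists T [set A; B].
- by exists A; left.
- by left; apply: Cmin; right.
- by right; apply: Cmin; left.
Qed.

(** * Pi-bases indexed by finite sequences, and the transfer of nowhere dense sets *)

Section PiTree.
Variable L : Type.

(* The children of the node [s] are the nodes [i :: s]. *)
Record pi_tree (Z : topologicalType) (U : seq L -> set Z) : Prop := PiTree {
  pi_tree_open : forall s, open (U s);
  pi_tree_nonempty : forall s, U s !=set0;
  pi_tree_child : forall s i, U (i :: s) `<=` U s;
  pi_tree_disj : forall s i j x, U (i :: s) x -> U (j :: s) x -> i = j;
  pi_tree_base : forall O : set Z, open O -> O !=set0 ->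
    exists s, U s `<=` O }.

Section OneTree.
Variables (Z : topologicalType) (U : seq L -> set Z).
Hypothesis treeU : pi_tree U.

Lemma pi_tree_cat r s : U (r ++ s) `<=` U s.
Proof.
by elim: r => // i r IH x /(pi_tree_child treeU)/IH.
Qed.

Lemma pi_tree_eq s t x : size s = size t -> U s x -> U t x -> s = t.
Proof.
elim: s t => [|i s IH] [|j t] //= [st] Us Ut.
have e := IH t st (pi_tree_child treeU Us) (pi_tree_child treeU Ut).
by move: Us Ut; rewrite e => /(pi_tree_disj treeU) h /h ->.
Qed.

(** Children are added at the head, so the ancestors of a node are its suffixes. The suffix of [t]
    of length [size s] also has [x] in its open set, and nodes of one level are disjoint. *)
Lemma pi_tree_suffix s t x : (size s <= size t)%N -> U s x -> U t x ->
  exists r, t = r ++ s.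
Proof.
move=> st Us Ut; exists (take (size t - size s) t).
rewrite -{1}(cat_take_drop (size t - size s) t); congr (_ ++ _).
apply: (@pi_tree_eq _ _ x) Us; first by rewrite size_drop subKn.
by move: Ut; rewrite -{1}(cat_take_drop (size t - size s) t) => /pi_tree_cat.
Qed.

(** This expresses nowhere density by the tree alone, so that it can be carried between spaces with
    the same index tree. *)
Lemma nwdP (A : set Z) :
  nwd Z A <-> forall s, exists r, forall x, U (r ++ s) x -> ~ A x.
Proof.
split=> [nA s|nA].
  have [|t tO] := pi_tree_base treeU
      (openI (pi_tree_open treeU s) (closed_openC (@closed_closure _ A))).
    apply: contrapT => nO.
    have : U s `<=` (closure A)°.
      rewrite -open_subsetE; last exact: pi_tree_open.
      by move=> x Ux; apply: contrapT => nx; apply: nO; exists x.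
    by have [x Ux] := pi_tree_nonempty treeU s; move/(_ x Ux); rewrite nA.
  have [x Ut] := pi_tree_nonempty treeU t.
  have Us := (tO _ Ut).1.
  have tA y : U t y -> ~ A y by move=> /tO[_ ny] /subset_closure.
  (* The node [t] from the pi-base is comparable with [s] but may be an ancestor of it; then [U s]
     itself misses [A], and [r] is empty. *)
  have [st|/ltnW ts] := leqP (size s) (size t).
    by have [r def_t] := pi_tree_suffix st Us Ut; exists r; rewrite -def_t.
  have [r def_s] := pi_tree_suffix ts Ut Us.
  by exists [::] => y; rewrite /= def_s => /pi_tree_cat; exact: tA.
rewrite /nwd /=; apply: contrapT => /eqP/set0P.
case/(pi_tree_base treeU (open_interior _)) => s sA.
have [r rA] := nA s; have [x Ux] := pi_tree_nonempty treeU (r ++ s).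
have /interior_subset : (closure A)° x by exact/sA/(pi_tree_cat Ux).
case/(_ _ (open_nbhs_nbhs (conj (pi_tree_open treeU _) Ux))) => y [Ay Uy].
exact: rA Ay.
Qed.

End OneTree.

Variables (Z1 Z2 : topologicalType) (U : seq L -> set Z1) (V : seq L -> set Z2).
Hypotheses (treeU : pi_tree U) (treeV : pi_tree V).
Hypothesis L_infinite : infinite_set [set: L].

(** Below a node [t] with [U t] disjoint from [Y], no node contributes a point; the ancestors of [t]
    contribute finitely many, and one of the infinitely many children of [t] avoids them. *)
Lemma nwd_points (y : seq L -> Z2) (Y : set Z1) : (forall s, V s (y s)) ->
  nwd Z1 Y -> nwd Z2 [set y s | s in [set s | U s `&` Y !=set0]].
Proof.
move=> Vy /(nwdP treeU) nY; apply/(nwdP treeV) => s.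
have [r rY] := nY s; set t := r ++ s in rY.
(* A point y u of the set that lies in V t comes from one of the finitely many
   suffixes u of t, and it lies in at most one V (i :: t). *)
suff [i ti] : exists i, forall u, (size u <= size t)%N -> ~ V (i :: t) (y u).
  exists (i :: r) => _ /[swap] -[u [z [Uz Yz]] <-] Vu.
  have [ut|/ltnW tu] := leqP (size u) (size t); first exact: ti Vu.
  have [q def_u] := pi_tree_suffix treeV tu (pi_tree_child treeV Vu) (Vy u).
  by apply: rY Yz; move: Uz; rewrite def_u => /(pi_tree_cat treeU).
apply: contrapT => nti.
have {}nti i : exists k, (k <= size t)%N /\ V (i :: t) (y (drop (size t - k) t)).
  apply: contrapT => nk; apply: nti; exists i => u ut Vu; apply: nk.
  have [q def_t] := pi_tree_suffix treeV ut (Vy u) (pi_tree_child treeV Vu).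
  exists (size u); split=> //.
  suff -> : drop (size t - size u) t = u by [].
  by rewrite def_t size_cat addnK drop_size_cat.
have [k kP] := choice nti.
(* The length [k i] determines the suffix, hence the point, and disjoint children hold distinct
   points: [k] embeds [L] into a finite set. *)
apply: L_infinite; apply: (card_le_finite _ (finite_II (size t).+1)).
apply: (@card_le_inj _ _ _ _ k) => [i _|i j _ _ kij].
  by have [] := kP i.
have [[_ Vi] [_ Vj]] := (kP i, kP j).
by rewrite kij in Vi; exact: pi_tree_disj Vi Vj.
Qed.

Lemma cof_nwd_le : cof (nwd Z1) #<= cof (nwd Z2).
Proof.
have [[W_nwd W_cof] _] := least_cardP (cofinal_nonempty (nwd Z2)).
rewrite -/(cof (nwd Z2)) in W_nwd W_cof.
pose Psi (C : set Z2) : set Z1 :=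
  [set x | forall s, U s x -> V s `&` C !=set0].
have [_ /(_ [set Psi C | C in cof (nwd Z2)])] :=
  least_cardP (cofinal_nonempty (nwd Z1)).
move=> le; apply: card_le_trans (le _) (card_image_le _ _) => {le}; split.
  move=> _ [C /W_nwd/(nwdP treeV) nC <-]; apply/(nwdP treeU) => s.
  have [r rC] := nC s; exists r => x Ux /(_ _ Ux) [y [Vy]]; exact: rC.
move=> Y nY.
have [y Vy] := choice (pi_tree_nonempty treeV).
have [C WC YC] := W_cof _ (nwd_points Vy nY).
exists (Psi C); first by exists C.
move=> x Yx s Us; exists (y s); split=> //.
by apply: YC; exists s => //; exists x.
Qed.

End PiTree.

(** * Maximal disjoint families of small open sets in the metric space *)

Section Cellular.
Variables (R : realType) (X : metricType R).
Implicit Types (U V A B O : set X) (M N G : set (set X)) (k m n : nat).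

Definition small k A := forall x y, A x -> A y -> ball x (k.+1%:R^-1 : R)%R y.

Definition cellular k U M :=
  (forall A, M A -> [/\ open A, A !=set0, A `<=` U & small k A]) /\
  (forall A B x, M A -> M B -> A x -> B x -> A = B).

(** Maximality is phrased as density of the union of [M] in [U], the form used for counting. *)
Definition maximal_cellular k U M := cellular k U M /\
  forall V, open V -> V !=set0 -> V `<=` U -> exists2 A, M A & A `&` V !=set0.

Lemma small_open k V : open V -> V !=set0 ->
  exists A, [/\ open A, A !=set0, A `<=` V & small k A].
Proof.
move=> oV [x Vx]; have e0 : (0 < (k.+1%:R^-1 : R) / 2)%R.
  by rewrite divr_gt0 ?invr_gt0 ?ltr0Sn.
exists (V `&` (ball x ((k.+1%:R^-1 : R) / 2)%R)°); split.
- exact: openI (open_interior _).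
- by exists x; split => //; exact: nbhsx_ballx.
- exact: subIsetl.
move=> y z [_ /interior_subset xy] [_ /interior_subset xz].
exact: ball_splitr xy xz.
Qed.

Lemma maximal_cellular_exists k U G : cellular k U G ->
  exists2 M, maximal_cellular k U M & G `<=` M.
Proof.
(* Zorn's lemma is applied to the part added to [G], so that the empty chain causes no trouble. *)
move=> cG; pose P M := cellular k U (G `|` M).
have [|M [cM maxM]] := @Zorn_bigcup _ P.
  move=> F FP Ftot; split=> [A [GA|[M FM MA]]|A B x].
  - exact: cG.1.
  - by apply: (FP _ FM).1; right.
  move=> [GA|[M FM MA]] [GB|[N FN NB]].
  - exact: cG.2 GA GB.
  - by apply: (FP _ FN).2; [left|right].
  - by apply: (FP _ FM).2; [right|left].
  - have [MN|NM] := Ftot _ _ FM FN.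
      by apply: (FP _ FN).2; right => //; exact: MN.
    by apply: (FP _ FM).2; right => //; exact: NM.
exists (G `|` M); last by move=> A; left.
split=> // V oV V0 VU; apply: contrapT => nV.
have [A [oA A0 AV sA]] := small_open k oV V0.
have disjA B x : (G `|` M) B -> B x -> ~ A x.
  by move=> MB Bx Ax; apply: nV; exists B => //; exists x; split => //; exact: AV.
apply: (maxM (M `|` [set A])).
  split; first by move=> B; left.
  move=> /(_ A (or_intror erefl)) MA.
  have [x Ax] := A0; have GMA : (G `|` M) A by right.
  exact: (disjA A x GMA Ax Ax).
rewrite /P setUA; split=> [B [MB|->]|B C x [MB|->] [MC|->]] //.
- exact: cM.1.
- by split=> //; exact: subset_trans VU.
- exact: cM.2.
- by move=> Bx /(disjA _ _ MB Bx).
- by move=> /[swap] /(disjA _ _ MC).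
Qed.

Variable L : Type.
Hypothesis L_infinite : infinite_set [set: L].
Hypothesis X_density : forall U, open U -> U !=set0 ->
  density (set_type U) #= [set: L].

Lemma card_le_dense U (D : set X) : open U -> U !=set0 ->
  (forall V, open V -> V !=set0 -> V `<=` U -> D `&` V !=set0) ->
  [set: L] #<= D.
Proof.
move=> oU U0 dD.
have /card_eqPle[_ le] := X_density oU U0; apply: card_le_trans le _.
have [_ /(_ [set d : set_type U | D (set_val d)])] :=
  least_cardP (dense_nonempty (set_type U)).
move=> le; apply: card_le_trans (le _) _ => {le}.
  move=> O [u Ou] [W oW def_O].
  have [||x|x [Dx [Wx Ux]]] := dD (W `&` U).
  - exact: openI.
  - exists (set_val u); split; last exact: set_valP.
    by rewrite -def_O in Ou.
  - by case.
  - by exists (SigSub (mem_set Ux)); split=> //; rewrite -def_O.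
by apply: (@card_le_inj _ _ _ _ set_val) => // x y _ _; exact: val_inj.
Qed.

(** Each member contains a point of a dense subset of [U] of size [L], and disjointness makes this
    choice injective. *)
Lemma cellular_card_le k U M : open U -> U !=set0 -> cellular k U M ->
  M #<= [set: L].
Proof.
move=> oU [u Uu] cM.
have /card_eqPle[le _] := X_density oU (ex_intro _ u Uu).
apply: card_le_trans le.
have [dD _] := least_cardP (dense_nonempty (set_type U)).
rewrite -/(density (set_type U)) in dD *.
have fex A : exists d : set_type U, M A ->
    density (set_type U) d /\ A (set_val d).
  have [MA|] := pselect (M A).
    have [oA [a Aa] AU _] := cM.1 _ MA.
    have [||d [Ad Dd]] := dD [set d | A (set_val d)].
    - by exists (SigSub (mem_set (AU _ Aa))).
    - by exists A.
    - by exists d.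
  by exists (SigSub (mem_set Uu)).
have [f fP] := choice fex.
apply: (@card_le_inj _ _ _ _ f) => [A /fP[]//|A B MA MB eqf].
by apply: (cM.2 _ _ (set_val (f A))) => //; [|rewrite eqf]; apply fP.
Qed.

(** A subspace with at most one point would have finite density. *)
Lemma open_not_subsingleton U : open U -> U !=set0 ->
  exists x y, [/\ U x, U y & x != y].
Proof.
move=> oU U0; apply: contrapT => sub.
have /card_eqPle[_ le] := X_density oU U0.
apply: L_infinite; apply: card_le_finite le _.
apply: card_le_finite (subset_card_le (@subsetT _ _)) _.
apply: (@card_le_finite _ _ _ `I_1); last exact: finite_II.
apply: (@card_le_inj _ _ _ _ (fun=> 0%N)) => // x y _ _ _; apply: val_inj.
apply/eqP/negP => xy; apply: sub; exists (set_val x), (set_val y).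
by split; [exact: set_valP|exact: set_valP|exact/negP].
Qed.

Lemma open_fork U : open U -> U !=set0 -> exists AB : set X * set X,
  [/\ open AB.1 /\ AB.1 !=set0, open AB.2 /\ AB.2 !=set0,
      AB.1 `<=` U, AB.2 `<=` U & forall x, AB.1 x -> ~ AB.2 x].
Proof.
move=> oU U0; have [x [y [Ux Uy xy]]] := open_not_subsingleton oU U0.
have := @metric_hausdorff R X; rewrite open_hausdorff => /(_ x y xy).
case=> -[A B] /= [/set_mem Ax /set_mem By] [oA oB /eqP AB].
exists (U `&` A, U `&` B); split=> /=.
- by split; [exact: openI|exists x].
- by split; [exact: openI|exists y].
- by move=> ? [].
- by move=> ? [].
- move=> z [_ Az] [_ Bz]; suff : set0 z by []. by rewrite -AB.
Qed.

Lemma open_sequence U : open U -> U !=set0 -> exists O : nat -> set X,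
  (forall n, [/\ open (O n), O n !=set0 & O n `<=` U]) /\
  (forall m n x, O m x -> O n x -> m = n).
Proof.
move=> oU U0.
have fex V : exists AB : set X * set X, open V /\ V !=set0 ->
    [/\ open AB.1 /\ AB.1 !=set0, open AB.2 /\ AB.2 !=set0,
      AB.1 `<=` V, AB.2 `<=` V & forall x, AB.1 x -> ~ AB.2 x].
  have [[oV V0]|nV] := pselect (open V /\ V !=set0).
    by have [AB] := open_fork oV V0; exists AB.
  by exists (V, V) => /nV.
have [f fP] := choice fex.
(* [W n] is what is left after [n] forks; each fork gives its first part to the sequence and passes
   its second part on. *)
pose W n := iter n (fun V => (f V).2) U.
have WP n : open (W n) /\ W n !=set0.
  by elim: n => //= n /fP[].
have WS n m : (n <= m)%N -> W m `<=` W n.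
  elim: m => [|m IH]; first by rewrite leqn0 => /eqP ->.
  rewrite leq_eqVlt ltnS => /predU1P[->//|/IH].
  by apply: subset_trans; have [] := fP _ (WP m).
have disj m n x : (m < n)%N -> (f (W m)).1 x -> ~ (f (W n)).1 x.
  move=> mn fx; have [_ _ s _ _] := fP _ (WP n) => /s /(WS _ _ mn).
  by have [_ _ _ _] := fP _ (WP m); exact.
exists (fun n => (f (W n)).1); split=> [n|m n x Om On].
  have [[? ?] _ s _ _] := fP _ (WP n); split=> //.
  exact: subset_trans s (WS _ _ (leq0n n)).
by have [/disj/(_ Om)|/disj/(_ On)|] := ltngtP m n.
Qed.

(** One point from each member of each [M n] makes a set dense in [U], since each [M n] has dense
    union and its members shrink as [n] grows. *)
Lemma bigcup_maximal_cellular_card U k (M : nat -> set (set X)) :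
  open U -> U !=set0 -> (forall n, maximal_cellular (k + n) U (M n)) ->
  [set: L] #<= \bigcup_n M n.
Proof.
move=> oU U0 maxM; have [u Uu] := U0.
have pex A : exists a : X, A !=set0 -> A a.
  have [[a Aa]|nA] := pselect (A !=set0).
    by exists a.
  by exists u => /nA.
have [p pP] := choice pex.
apply: card_le_trans (card_image_le p _).
apply: (card_le_dense oU U0) => V oV [x Vx] VU.
have /nbhs_ballP[e /= e0 eV] : nbhs x V by exact: open_nbhs_nbhs.
have [n] := ltr_add_invr (divr_gt0 e0 (ltr0Sn R 1)); rewrite add0r => ne.
have [cM mM] := maxM n.
(* Half of [e] is for reaching a member of [M n], the other half for moving inside it to its chosen
   point. *)
have [||y [Vy _]|A MA [y [Ay [Vy /interior_subset xy]]]] :=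
  mM (V `&` (ball x (e / 2)%R)°).
- exact: openI (open_interior _).
- by exists x; split => //; apply: nbhsx_ballx; exact: divr_gt0.
- exact: VU.
have [_ A0 _ sA] := cM.1 _ MA; exists (p A); split.
  by exists A => //; exists n.
apply: eV; apply: ball_split xy _.
apply: le_ball (sA _ _ Ay (pP _ A0)).
apply: le_trans (ltW ne); rewrite lef_pV2 ?posrE ?ltr0Sn // ler_nat.
by rewrite ltnS leq_addl.
Qed.

(* No cardinal arithmetic: compare the maximal families M n of U with those,
   N n m, of disjoint open subsets O n of U.  Either each M n injects into some
   N n m, and the sets O n keep the copies of the M n disjoint; or some M n is
   at least as large as all the N n m, and splitting each member of M n into a
   sequence makes room for the union of the N n m over m, which has size L. *)
Lemma cellular_card_ge U k : open U -> U !=set0 ->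
  exists2 M, cellular k U M & [set: L] #<= M.
Proof.
move=> oU U0; have [O [OP Odisj]] := open_sequence oU U0.
have max_ex V n : exists M, maximal_cellular (k + n) V M.
  have [|M] := @maximal_cellular_exists (k + n) V set0; last by exists M.
  by split.
have [M maxM] := choice (max_ex U).
have leM := bigcup_maximal_cellular_card oU U0 maxM.
have Nex n : exists K : nat -> set (set X),
    forall m, maximal_cellular (k + m) (O n) (K m).
  by have [K] := choice (max_ex (O n)); exists K.
have [N maxN] := choice Nex.
have small_le i j A : (i <= j)%N -> small j A -> small i A.
  move=> ij sA x y Ax Ay; apply: le_ball (sA x y Ax Ay).
  by rewrite lef_pV2 ?posrE ?ltr0Sn // ler_nat ltnS.
have [MN|] := pselect (forall n, exists m, M n #<= N n m).
  have [m mP] := choice MN.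
  have [g gP] := choice (fun n => card_le_injfun (mP n)).
  have NP n A : N n (m n) A -> [/\ open A, A !=set0, A `<=` O n & small k A].
    move=> /((maxN n (m n)).1.1)[oA A0 AO sA]; split=> //.
    by apply: small_le sA; rewrite leq_addr.
  exists (\bigcup_n N n (m n)).
    split=> [A [n _ /NP[oA A0 AO sA]]|A B x [n _ NA] [n' _ NB] Ax Bx].
      by split=> //; apply: subset_trans AO _; case: (OP n).
    have [_ _ /(_ _ Ax) On _] := NP _ _ NA.
    have [_ _ /(_ _ Bx) On' _] := NP _ _ NB.
    have nn' := Odisj _ _ _ On On'; rewrite -nn' in NB.
    exact: (maxN n (m n)).1.2 NA NB Ax Bx.
  apply: card_le_trans leM _.
  have lex A : exists n, (\bigcup_n M n) A -> M n A.
    have [[n _ MA]|nMA] := pselect ((\bigcup_n M n) A); first by exists n.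
    by exists 0%N.
  have [l lP] := choice lex.
  (* A set can belong to several [M n]; [l] fixes one. Equal images share a point of some [O n],
     which forces equal indices. *)
  apply: (@card_le_inj _ _ _ _ (fun A => g (l A) A)) => [A /lP MA|A B].
    by exists (l A) => //; apply: (gP _).1.
  move=> /lP MA /lP MB eqg.
  have [_ [x gAx] AO _] := NP _ _ ((gP _).1 _ MA).
  have gBx := gAx; rewrite eqg in gBx.
  have [_ _ BO _] := NP _ _ ((gP _).1 _ MB).
  have ll := Odisj _ _ _ (AO _ gAx) (BO _ gBx).
  by move: MB eqg; rewrite -ll => MB; exact: (gP _).2.
(* By comparability, every [N n m] now injects into this one [M n]. *)
move=> /existsNP[n /forallNP nM].
have NM m : N n m #<= M n by have [/nM|] := card_le_total (M n) (N n m).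
have [g gP] := choice (fun m => card_le_injfun (NM m)).
have MP A : M n A -> [/\ open A, A !=set0, A `<=` U & small k A].
  move=> /((maxM n).1.1)[oA A0 AU sA]; split=> //.
  by apply: small_le sA; rewrite leq_addr.
have Sex A : exists S : nat -> set X, M n A ->
    (forall j, [/\ open (S j), S j !=set0 & S j `<=` A]) /\
    (forall i j x, S i x -> S j x -> i = j).
  have [MA|] := pselect (M n A); last by exists (fun=> set0).
  have [oA A0 _ _] := MP _ MA; have [S] := open_sequence oA A0.
  by exists S.
have [S SP] := choice Sex.
exists [set S A j | A in M n & j in setT].
  split=> [_ [A MA [j _ <-]]|_ _ x [A MA [i _ <-]] [B MB [j _ <-]] SAx SBx].
    have [_ _ AU sA] := MP _ MA; have [oS S0 SA] := (SP _ MA).1 j.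
    split=> //; first exact: subset_trans SA AU.
    by move=> x y /SA Ax /SA; exact: sA.
  have [_ _ /(_ _ SAx) Ax] := (SP _ MA).1 i.
  have [_ _ /(_ _ SBx) Bx] := (SP _ MB).1 j.
  have AB := (maxM n).1.2 _ _ _ MA MB Ax Bx; rewrite -AB in SBx *.
  by rewrite ((SP _ MA).2 _ _ _ SAx SBx).
have [oO O0 _] := OP n.
apply: card_le_trans (bigcup_maximal_cellular_card oO O0 (maxN n)) _.
have lex B : exists m, (\bigcup_m N n m) B -> N n m B.
  have [[m _ NB]|nNB] := pselect ((\bigcup_m N n m) B); first by exists m.
  by exists 0%N.
have [l lP] := choice lex.
(* A set [B] of [N n m] goes to piece number [m] of the member of [M n] that [g m] assigns to it;
   disjointness recovers both the member and the number. *)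
apply: (@card_le_inj _ _ _ _ (fun B => S (g (l B) B) (l B))) => [B /lP NB|].
  by exists (g (l B) B); [apply: (gP _).1|exists (l B)].
move=> B C /lP NB /lP NC eqS.
have MB := (gP _).1 _ NB; have MC := (gP _).1 _ NC.
have [_ [x SBx] SB] := (SP _ MB).1 (l B); have SCx := SBx; rewrite eqS in SCx.
have [_ _ SC] := (SP _ MC).1 (l C).
have eqg := (maxM n).1.2 _ _ _ MB MC (SB _ SBx) (SC _ SCx).
rewrite -eqg in SCx; have ll := (SP _ MB).2 _ _ _ SBx SCx.
by move: NC eqg; rewrite -ll => NC; exact: (gP _).2.
Qed.

(** The two bounds meet: a family of at least [L] members extends to a maximal one, which has at
    most [L] members, so [L] can index it. *)
Lemma open_split U k : open U -> U !=set0 -> exists f : L -> set X,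
  [/\ forall i, [/\ open (f i), f i !=set0, f i `<=` U & small k (f i)],
      forall i j x, f i x -> f j x -> i = j &
      forall V, open V -> V !=set0 -> V `<=` U ->
        exists i, f i `&` V !=set0].
Proof.
move=> oU U0; have [G cG LG] := cellular_card_ge k oU U0.
have [M [cM maxM] GM] := maximal_cellular_exists cG.
have : [set: L] #= M.
  apply/card_eqPle; split; first exact: card_le_trans LG (subset_card_le GM).
  exact: cellular_card_le oU U0 cM.
move=> /pcard_eqP/unsquash f; exists f; split=> [i|i j x fi fj|V oV V0 VU].
- by apply: cM.1; exact: funS.
- have inj_f := @inj _ _ _ f.
  apply: inj_f; rewrite ?inE //; apply: cM.2 fi fj; exact: funS.
- have [A MA AV] := maxM V oV V0 VU.
  by have [i _ fi] := @surj _ _ _ _ f _ MA; exists i; rewrite fi.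
Qed.

Lemma metric_pi_tree : [set: X] !=set0 ->
  exists T : seq L -> set X, pi_tree T.
Proof.
move=> X0.
have fex (kU : nat * set X) : exists f : L -> set X,
    open kU.2 /\ kU.2 !=set0 ->
  [/\ forall i, [/\ open (f i), f i !=set0, f i `<=` kU.2 & small kU.1 (f i)],
      forall i j x, f i x -> f j x -> i = j &
      forall V, open V -> V !=set0 -> V `<=` kU.2 ->
        exists i, f i `&` V !=set0].
  case: kU => k U /=; have [[oU U0]|nU] := pselect (open U /\ U !=set0).
    by have [f] := open_split k oU U0; exists f.
  by exists (fun=> set0) => /nU.
have [f fP] := choice fex.
(* The depth [size s] is the smallness index: sets of level [n.+1] satisfy [small n]. *)
pose T := fix T (s : seq L) :=
  if s is i :: s then f (size s, T s) i else [set: X].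
have TP s : open (T s) /\ T s !=set0.
  elim: s => [|i s IH] /=; first by split=> //; exact: openT.
  by have [/(_ i)[]] := fP (size s, T s) IH.
have Tdense n V : open V -> V !=set0 -> exists2 s, size s = n & T s `&` V !=set0.
  elim: n V => [|n IH] V oV V0.
    by exists [::] => //; rewrite setTI.
  have [s ss TV] := IH V oV V0.
  have [_ _ /(_ (T s `&` V))[]] := fP (size s, T s) (TP s).
  - by apply: openI => //; exact: (TP s).1.
  - exact: TV.
  - exact: subIsetl.
  move=> i [x [fx [_ Vx]]]; exists (i :: s); first by rewrite /= ss.
  by exists x.
exists T; split=> [s|s|s i|s i j x|O oO [x Ox]].
- exact: (TP s).1.
- exact: (TP s).2.
- by have [/(_ i)[]] := fP (size s, T s) (TP s).
- by have [_ + _] := fP (size s, T s) (TP s); exact.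
have /nbhs_ballP[e /= e0 eO] : nbhs x O by exact: open_nbhs_nbhs.
have [n] := ltr_add_invr (divr_gt0 e0 (ltr0Sn R 1)); rewrite add0r => ne.
(* Level [n.+1] is taken because the root [[::]] carries no bound on its size. *)
have [||[|i s] //= [sn] [y [Ty /interior_subset xy]]] :=
  Tdense n.+1 (ball x (e / 2)%R)°.
- exact: open_interior.
- by exists x; apply: nbhsx_ballx; exact: divr_gt0.
exists (i :: s) => z Tz; apply: eO; apply: ball_split xy _.
have [/(_ i)[_ _ _ sm] _ _] := fP (size s, T s) (TP s).
by apply: le_ball (sm _ _ Ty Tz); rewrite /= sn ltW.
Qed.

End Cellular.

(** * Cylinders in the space of sequences *)

Section Sequences.
Variable L : choiceType.
Local Notation Z := {ptws nat -> discrete_topology L}.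

(** Since children extend a node at the head, [s] lists an initial segment of [f] in reverse
    order. *)
Fixpoint cylinder (s : seq L) : set Z :=
  if s is i :: s' then cylinder s' `&` [set f | f (size s') = i] else setT.

Lemma cylinder_nonempty s : L -> cylinder s !=set0.
Proof.
move=> a; exists (fun n => nth a (rev s) n).
(* The free tail [r] lets the induction move the head of [s] into it. *)
suff : forall r, cylinder s (fun n => nth a (rev s ++ r) n).
  by move=> /(_ [::]); rewrite cats0.
elim: s => [//|i s IH] r /=; rewrite rev_cons cat_rcons; split; first exact: IH.
by rewrite /= nth_cat size_rev ltnn subnn.
Qed.

Lemma open_cylinder s : open (cylinder s).
Proof.
elim: s => [|i s IH]; first exact: openT.
apply: openI => //.
have cont : continuous (fun f : Z => f (size s)).
  exact: (@proj_continuous nat (fun=> discrete_topology L)).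
by move/continuousP: cont => /(_ [set i]); apply; exact: discrete_open.
Qed.

(** The filter generated by the sets [B n] converges to [f] in each coordinate, hence in the product
    topology. *)
Lemma nbhs_cylinder (f : Z) (A : set Z) : nbhs f A ->
  exists n, forall g : Z, (forall m, (m < n)%N -> g m = f m) -> A g.
Proof.
pose B n := [set g : Z | forall m, (m < n)%N -> g m = f m].
have FF : Filter (filter_from [set: nat] B).
  apply: filter_from_filter; first by exists 0%N.
  move=> i j _ _; exists (maxn i j) => // g Bg; split=> m mi; apply: Bg.
    by rewrite leq_max mi.
  by rewrite leq_max mi orbT.
suff cvgB : filter_from [set: nat] B --> f.
  by move=> /cvgB[n _ nA]; exists n.
apply/cvg_sup => i C; rewrite nbhsE => -[D [[E oE <-] Ef] DC].
exists i.+1 => // g Bg; apply: DC; rewrite /preimage /=.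
by rewrite Bg.
Qed.

Lemma cylinder_pi_tree : L -> pi_tree cylinder.
Proof.
move=> a; split=> [s|s|s i|s i j f [_ <-] [_ <-]|O oO [f Of]] //.
- exact: open_cylinder.
- exact: cylinder_nonempty.
- by move=> f [].
have [n nO] := nbhs_cylinder (open_nbhs_nbhs (conj oO Of)).
exists (rev (mkseq f n)) => g cg; apply: nO => m.
elim: n cg => [//|n IH]; rewrite mkseqS rev_rcons => -[cg gn].
rewrite ltnS leq_eqVlt => /predU1P[->|]; last exact: IH.
by move: gn; rewrite /= size_rev size_mkseq.
Qed.

End Sequences.

Theorem theorem12 (R : realType) (L : choiceType) (X : metricType R)
  (L_infinite : infinite_set [set: L])
  (X_nonempty : [set: X] !=set0)
  (X_density : forall U : set X, open U -> U !=set0 ->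
    density (set_type U) #= [set: L]) :
  cof (nwd {ptws nat -> discrete_topology L}) #= cof (nwd X).
Proof.
have [a _] : [set: L] !=set0.
  apply: contrapT => nL; apply: L_infinite.
  suff -> : [set: L] = set0 by exact: finite_set0.
  by rewrite -subset0 => x _; apply: nL; exists x.
have treeL := cylinder_pi_tree a.
have [T treeX] := metric_pi_tree L_infinite X_density X_nonempty.
apply/card_eqPle; split.
  exact: (cof_nwd_le treeL treeX L_infinite).
exact: (cof_nwd_le treeX treeL L_infinite).
Qed.
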